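(* Let $G_1$ be an $r_1$-regular graph on $n_1$ vertices and $m_1$ edges, and $G_2$ an arbitrary graph on $n_2$ vertices. Then $$t(G_1\underline{\vee} G_2)=\frac{(2+n_2)^{m_1-n_1}\cdot(r_1n_2+r_1m_1+2m_1)\cdot\prod_{i=2}^{n_2}\Big(m_1+\mu_i(G_2)\Big)\cdot\prod_{i=2}^{n_1}\Big(r_1n_2+\mu_i(G_1)\Big)}{m_1+n_1+n_2}.$$
   Context: All graphs are finite, simple and undirected, with at least one vertex. $t(G)$ denotes the number of spanning trees of $G$. For a graph $G$ on $n$ vertices, $0=\mu_1(G)\le\mu_2(G)\le\cdots\le\mu_n(G)$ are the eigenvalues of the Laplacian matrix $L(G)=D(G)-A(G)$ ($D(G)$ the diagonal degree matrix, $A(G)$ the adjacency matrix). The subdivision graph $\mathcal{S}(G)$ is obtained from $G$ by inserting a new vertex into every edge of $G$; $I(G)$ denotes the set of inserted vertices. For vertex-disjoint graphs $G_1,G_2$, the subdivision-edge join $G_1\underline{\vee}G_2$ is the graph obtained from $\mathcal{S}(G_1)$ and $G_2$ by joining every vertex of $I(G_1)$ with every vertex of $V(G_2)$. *)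

(* Defs.v *)
From HB Require Import structures.
From mathcomp Require Import all_boot all_order all_algebra.
From mathcomp Require Import complex.

Set Implicit Arguments.
Unset Strict Implicit.
Unset Printing Implicit Defensive.

Import Order.TTheory GRing.Theory Num.Theory.

Local Open Scope nat_scope.

Record sgraph (V : finType) := SGraph {
  adj :> rel V;
  adj_sym : symmetric adj;
  adj_irrefl : irreflexive adj }.

Section Graphs.
Variable V : finType.
Implicit Types (G : sgraph V) (F : {set {set V}}).

Definition deg G (x : V) : nat := #|[set y | G x y]|.

Definition regular G (r : nat) : Prop := forall x, deg G x = r.

Definition edges G : {set {set V}} :=
  [set e | [exists x, exists y, G x y && (e == [set x; y])]].

Lemma edgesE G x y : ([set x; y] \in edges G) = G x y.
Proof.
rewrite inE; apply/existsP/idP => [[a /existsP[b /andP[Gab /eqP E]]] | Gxy].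
  have ne : a != b by apply/eqP => ab; move: Gab; rewrite ab adj_irrefl.
  have := set21 x y; have := set22 x y; rewrite E !inE.
  have := set21 a b; have := set22 a b; rewrite -E !inE.
  move=> /orP[]/eqP ? /orP[]/eqP ? _ _; subst => //; rewrite ?eqxx // in ne.
  by rewrite adj_sym.
by exists x; apply/existsP; exists y; rewrite Gxy eqxx.
Qed.

Definition connected G : bool := [forall x, forall y, connect G x y].

(* A cycle is a cyclic sequence of at least 3 pairwise distinct vertices;
   such a sequence has at most #|V| vertices, hence the finite quantifiers. *)
Definition acyclic G : bool :=
  [forall k : 'I_#|V|.+1, forall c : k.-tuple V, (2 < k) ==> ~~ ucycleb G c].

Lemma acyclicP G :
  reflect (forall c : seq V, 2 < size c -> ~ ucycle G c) (acyclic G).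
Proof.
apply: (iffP idP) => [acG c c2 cG | acG].
  have uc : uniq c by case/andP: cG.
  have sc : size c < #|V|.+1 by rewrite ltnS -(card_uniqP uc) max_card.
  move/forallP/(_ (Ordinal sc))/forallP/(_ (in_tuple c)): acG.
  by rewrite /= c2 /= => /negP; apply.
apply/forallP => k; apply/forallP => c; apply/implyP => k2.
by apply/negP; apply: acG; rewrite size_tuple.
Qed.

Definition is_tree G : bool := connected G && acyclic G.

Section EdgeSubgraph.
Variable F : {set {set V}}.
Definition edge_rel : rel V := fun x y => (x != y) && ([set x; y] \in F).
Lemma edge_rel_sym : symmetric edge_rel.
Proof. by move=> x y; rewrite /edge_rel eq_sym setUC. Qed.
Lemma edge_rel_irrefl : irreflexive edge_rel.
Proof. by move=> x; rewrite /edge_rel eqxx. Qed.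
Definition edge_graph : sgraph V := SGraph edge_rel_sym edge_rel_irrefl.
End EdgeSubgraph.

(* A spanning tree is identified with its edge set. *)
Definition spanning_trees G : {set {set {set V}}} :=
  [set F : {set {set V}} | (F \subset edges G) && is_tree (edge_graph F)].

Definition nb_spanning_trees G : nat := #|spanning_trees G|.

End Graphs.

Section Subdivision.
Variables (V : finType) (G : sgraph V).

Definition edge_type : finType := {e : {set V} | e \in edges G}.

(* [inl x] is an original vertex, [inr e] is the vertex inserted into e. *)
Definition subdiv_rel : rel (V + edge_type) := fun a b =>
  match a, b with
  | inl x, inr e => x \in val e
  | inr e, inl x => x \in val e
  | _, _ => false
  end.
Lemma subdiv_sym : symmetric subdiv_rel.
Proof. by case=> [x|e] [y|f]. Qed.
Lemma subdiv_irrefl : irreflexive subdiv_rel.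
Proof. by case. Qed.
Definition subdivision : sgraph (V + edge_type)%type :=
  SGraph subdiv_sym subdiv_irrefl.

Definition inserted : {set V + edge_type} := [set inr e | e : edge_type].

End Subdivision.

Section SubdivisionEdgeJoin.
Variables (V1 V2 : finType) (G1 : sgraph V1) (G2 : sgraph V2).

Definition sejoin_rel : rel ((V1 + edge_type G1) + V2) := fun a b =>
  match a, b with
  | inl x, inl y => subdivision G1 x y
  | inr u, inr v => G2 u v
  | inl x, inr _ => x \in inserted G1
  | inr _, inl y => y \in inserted G1
  end.
Lemma sejoin_sym : symmetric sejoin_rel.
Proof. by case=> [x|u] [y|v] //=; [apply: subdiv_sym | apply: adj_sym]. Qed.
Lemma sejoin_irrefl : irreflexive sejoin_rel.
Proof. by case=> [x|u] /=; [apply: subdiv_irrefl | apply: adj_irrefl]. Qed.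
Definition subdivision_edge_join : sgraph ((V1 + edge_type G1) + V2)%type :=
  SGraph sejoin_sym sejoin_irrefl.

End SubdivisionEdgeJoin.

Local Open Scope ring_scope.

Lemma char_poly_conj (F : fieldType) n (P A : 'M[F]_n) :
  P \in unitmx -> char_poly (invmx P *m A *m P) = char_poly A.
Proof.
move=> uP; rewrite /char_poly /char_poly_mx !map_mxM /=.
set Q := map_mx polyC P.
have -> : 'X%:M - map_mx polyC (invmx P) *m map_mx polyC A *m Q
   = map_mx polyC (invmx P) *m ('X%:M - map_mx polyC A) *m Q.
  rewrite mulmxBr mulmxBl; congr (_ - _).
  by rewrite mul_mx_scalar -scalemxAl -map_mxM mulVmx // map_mx1 scalemx1.
rewrite !det_mulmx mulrAC [X in X * _](_ : _ = 1) ?mul1r //.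
by rewrite -det_mulmx -map_mxM mulVmx // map_mx1 det1.
Qed.

Lemma symmetric_splits (R : rcfType) n (A : 'M[R]_n) : A^T = A ->
  exists s : seq R,
    sorted <=%R s && (char_poly A == \prod_(x <- s) ('X - x%:P)).
Proof.
move=> symA; pose f : {rmorphism R -> R[i]} := real_complex R.
pose B := map_mx f A.
have Bherm : B \is hermsymmx.
  apply: realsym_hermsym.
    by apply/is_hermitianmxP; rewrite expr0 scale1r map_mx_id // /B -[in LHS]symA map_trmx.
  by apply/mxOverP => i j; rewrite mxE; apply/complex_realP; exists (A i j).
have /orthomx_spectralP eqB := hermitian_normalmx Bherm.
have /mxOverP dreal := hermitian_spectral_diag_real Bherm.
pose d i := complex.Re (spectral_diag B 0 i).
have dE i : f (d i) = spectral_diag B 0 i by apply: RRe_real.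
pose s := sort <=%R [seq d i | i <- enum 'I_n].
exists s; rewrite sort_le_sorted /=; apply/eqP.
apply: (map_poly_inj f); rewrite map_char_poly -/B eqB.
rewrite char_poly_conj ?spectral_unit // char_poly_trig ?diag_mx_is_trig //.
rewrite (perm_big [seq d i | i <- enum 'I_n]) ?perm_sort //= big_map big_enum.
rewrite rmorph_prod /=; apply: eq_bigr => i _.
by rewrite rmorphB /= map_polyX map_polyC /= dE mxE eqxx.
Qed.

Section Laplacian.
Variables (R : rcfType) (V : finType) (G : sgraph V).

Definition degree_mx : 'M[R]_#|V| := diag_mx (\row_i (deg G (enum_val i))%:R).
Definition adjacency_mx : 'M[R]_#|V| :=
  \matrix_(i, j) (G (enum_val i) (enum_val j))%:R.
Definition laplacian : 'M[R]_#|V| := degree_mx - adjacency_mx.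

Lemma laplacian_sym : laplacian^T = laplacian.
Proof.
rewrite /laplacian linearB /= tr_diag_mx; congr (_ - _).
by apply/matrixP => i j; rewrite !mxE adj_sym.
Qed.

(* The eigenvalues of the Laplacian with multiplicities, in nondecreasing
   order; [xchoose] is harmless as this sequence is unique. *)
Definition laplacian_spectrum : seq R :=
  xchoose (symmetric_splits laplacian_sym).

Lemma laplacian_spectrum_sorted : sorted <=%R laplacian_spectrum.
Proof. by case/andP: (xchooseP (symmetric_splits laplacian_sym)). Qed.

Lemma char_poly_laplacian :
  char_poly laplacian = \prod_(x <- laplacian_spectrum) ('X - x%:P).
Proof. by case/andP: (xchooseP (symmetric_splits laplacian_sym)) => _ /eqP. Qed.

Lemma size_laplacian_spectrum : size laplacian_spectrum = #|V|.
Proof.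
apply: succn_inj; rewrite -(size_char_poly laplacian) char_poly_laplacian.
by rewrite size_prod_XsubC.
Qed.

(* Indexed from 1 to #|V|, as in mu_1 <= ... <= mu_n. *)
Definition mu (i : nat) : R := laplacian_spectrum`_i.-1.

End Laplacian.

(* Main.v *)
(* Let L and J be the Laplacian and the all-ones matrix of a graph on n vertices. The matrix-tree
   theorem is used in the form det(L + J) = n^2 t. Up to the factor n^2, this determinant is that
   of L with some row r replaced by the unit vector e_r. Expanding the other rows v as sums of
   e_v - e_w over the neighbours w of v gives a sum over the maps f that choose a neighbour of
   every v <> r; the term of f is 1 if the iterates of f lead every vertex to r, and 0 otherwise,
   and the maps of the first kind are the spanning trees oriented towards r.
   For the subdivision-edge join, the block of L + J between I(G1) and V(G2) is 0, so two Schur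
   complements eliminate V(G2) and then I(G1). As B B^T = 2 r1 - L(G1) for the incidence matrix B,
   they leave on V(G1) a combination of L(G1), the identity and J, and the spectrum of
   x + L + y J is that of x + L except on the constant vectors. If r1 = 0, then the vertices of G1
   are isolated in the join and both sides are 0. *)
Require Import Defs.
From mathcomp Require Import all_boot all_order all_algebra.
From mathcomp Require Import perm ring lra.

Set Implicit Arguments.
Unset Strict Implicit.
Unset Printing Implicit Defensive.

Import Order.TTheory GRing.Theory Num.Theory.
Local Open Scope ring_scope.

(** * Determinants indexed by finite types *)

Section FunctionDeterminant.
Variable R : fieldType.

(** Functions on finite types stand for matrices, so that entries are indexed by vertices and blocks
    by the two sides of a sum type. *)
Definition fun_mx (A B : finType) (M : A -> B -> R) : 'M[R]_(#|A|, #|B|) :=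
  \matrix_(i, j) M (enum_val i) (enum_val j).

Definition fdet (T : finType) (M : T -> T -> R) : R := \det (fun_mx M).

Lemma eq_fun_mx (A B : finType) (M N : A -> B -> R) : M =2 N -> fun_mx M = fun_mx N.
Proof. by move=> MN; apply/matrixP => i j; rewrite !mxE MN. Qed.

Lemma eq_fdet (T : finType) (M N : T -> T -> R) : M =2 N -> fdet M = fdet N.
Proof. by rewrite /fdet => /eq_fun_mx ->. Qed.

Lemma big_enum_val_all (T : finType) (idx : R) (op : Monoid.com_law idx) (F : T -> R) :
  \big[op/idx]_(i < #|T|) F (enum_val i) = \big[op/idx]_(x : T) F x.
Proof.
by rewrite [RHS](reindex (@enum_val T T)) //; apply: onW_bij; apply: enum_val_bij.
Qed.

Lemma mul_fun_mx (A B C : finType) (M : A -> B -> R) (N : B -> C -> R) :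
  fun_mx M *m fun_mx N = fun_mx (fun a c => \sum_b M a b * N b c).
Proof.
apply/matrixP => i k; rewrite !mxE -(big_enum_val_all _ (fun b => M _ b * N b _)).
by apply: eq_bigr => j _; rewrite !mxE.
Qed.

Lemma fun_mx1 (T : finType) : fun_mx (fun x y : T => (x == y)%:R) = 1%:M.
Proof. by apply/matrixP => i j; rewrite !mxE (inj_eq enum_val_inj). Qed.

Lemma fdetM (T : finType) (M N : T -> T -> R) :
  fdet (fun x z => \sum_y M x y * N y z) = fdet M * fdet N.
Proof. by rewrite /fdet -det_mulmx mul_fun_mx. Qed.

Lemma fdetZ (T : finType) a (M : T -> T -> R) :
  fdet (fun x y => a * M x y) = a ^+ #|T| * fdet M.
Proof.
by rewrite /fdet -detZ; congr (\det _); apply/matrixP => i j; rewrite !mxE.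
Qed.

(** The two enumerations differ by one permutation acting on both rows and columns, so its signs
    cancel. *)
Lemma det_reindex (T : finType) n p (s : 'I_n -> T) (t : 'I_p -> T) (M : T -> T -> R) :
  bijective s -> bijective t ->
  \det (\matrix_(i, j) M (s i) (s j)) = \det (\matrix_(i, j) M (t i) (t j)).
Proof.
move=> bs bt.
have np : n = p.
  by rewrite -(card_ord n) -(card_ord p) (bij_eq_card bs) (bij_eq_card bt).
subst p; have [t' tK Kt] := bt.
have inj : injective (t' \o s) by apply: inj_comp; [apply: can_inj Kt | apply: bij_inj].
pose q := perm inj.
have -> : \matrix_(i, j) M (s i) (s j)
   = row_perm q (col_perm q (\matrix_(i, j) M (t i) (t j))).
  by apply/matrixP => i j; rewrite !mxE !permE /= !Kt.
rewrite row_permE col_permE !det_mulmx !det_perm odd_permV mulrCA.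
by rewrite -signr_addb addbb mulr1.
Qed.

Lemma fdet_sum (A B : finType) (M : A + B -> A + B -> R) :
  fdet M = \det (block_mx (fun_mx (fun a b => M (inl a) (inl b)))
                          (fun_mx (fun a b => M (inl a) (inr b)))
                          (fun_mx (fun a b => M (inr a) (inl b)))
                          (fun_mx (fun a b => M (inr a) (inr b)))).
Proof.
pose t (i : 'I_(#|A| + #|B|)) : A + B :=
  match split i with inl a => inl (enum_val a) | inr b => inr (enum_val b) end.
have bt : bijective t.
  exists (fun x => unsplit (match x with inl a => inl (enum_rank a)
                                    | inr b => inr (enum_rank b) end)).
    by move=> i; rewrite -[RHS]splitK /t; case: (split i) => a; rewrite enum_valK.
  by case=> a; rewrite /t unsplitK enum_rankK.
rewrite /fdet [fun_mx M]/fun_mx (det_reindex M (@enum_val_bij _) bt).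
congr (\det _); apply/matrixP => i j; rewrite !mxE /t.
by case: (split i) => a; rewrite mxE; case: (split j) => b; rewrite !mxE.
Qed.

(* Elimination of the lower right block [D] by a right multiple of it, so that no inverse is needed. *)
Lemma fdet_schur (A B : finType) (M : A + B -> A + B -> R) (X : B -> A -> R) :
  (forall b a, \sum_c M (inr b) (inr c) * X c a = M (inr b) (inl a)) ->
  fdet M = fdet (fun a a' => M (inl a) (inl a') - \sum_c M (inl a) (inr c) * X c a')
           * fdet (fun b b' => M (inr b) (inr b')).
Proof.
move=> DX; rewrite fdet_sum; set P := fun_mx _; set Q := fun_mx _.
set C := fun_mx _; set D := fun_mx _.
have CE : C = D *m fun_mx X by rewrite mul_fun_mx; apply: eq_fun_mx.
have -> : block_mx P Q C D
  = block_mx (P - Q *m fun_mx X) Q 0 D *m block_mx 1%:M 0 (fun_mx X) 1%:M.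
  by rewrite mulmx_block !mulmx1 !mulmx0 ?mul0mx !add0r CE subrK.
rewrite det_mulmx det_ublock det_lblock !det1 !mulr1; congr (\det _ * _).
by rewrite mul_fun_mx; apply/matrixP => i j; rewrite !mxE.
Qed.

(** Both sides are the determinant of the bordered matrix with rows [(1, -u)] and [(v, 1)], factored
    by eliminating one or the other diagonal block. *)
Lemma det_1D_col_row n (u : 'cV[R]_n) (v : 'rV[R]_n) :
  \det (1%:M + u *m v) = 1 + (v *m u) 0 0.
Proof.
have E1 : \det (block_mx 1%:M (- u) v 1%:M : 'M[R]_(n + 1)) = \det (1%:M + u *m v).
  have -> : block_mx 1%:M (- u) v 1%:M
    = block_mx (1%:M + u *m v) (- u) 0 1%:M *m block_mx 1%:M 0 v 1%:M :> 'M[R]_(n + 1).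
    by rewrite mulmx_block !mulmx1 !mulmx0 ?mul0mx !add0r mul1mx mulNmx addrK.
  by rewrite det_mulmx det_ublock det_lblock !det1 !mulr1.
rewrite -E1.
have -> : block_mx 1%:M (- u) v 1%:M
  = block_mx 1%:M 0 v (1%:M + v *m u) *m block_mx 1%:M (- u) 0 1%:M :> 'M[R]_(n + 1).
  rewrite mulmx_block !mulmx1 !mulmx0 ?mul0mx ?mul1mx ?add0r ?addr0.
  by rewrite mulmxN addrC addrK.
by rewrite det_mulmx det_ublock det_lblock !det1 !mulr1 mul1r det_mx11 !mxE eqxx.
Qed.

Lemma fdet_1D (T : finType) (u v : T -> R) :
  fdet (fun x y => (x == y)%:R + u x * v y) = 1 + \sum_x v x * u x.
Proof.
pose U : 'cV[R]_#|T| := \col_i u (enum_val i).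
pose V : 'rV[R]_#|T| := \row_i v (enum_val i).
transitivity (\det (1%:M + U *m V)).
  rewrite -fun_mx1 /fdet; congr (\det _); apply/matrixP => i j.
  by rewrite !mxE big_ord1 !mxE.
rewrite det_1D_col_row mxE -(big_enum_val_all _ (fun x => v x * u x)).
by congr (_ + _); apply: eq_bigr => i _; rewrite !mxE.
Qed.

Lemma fdet_scalarD (T : finType) (x y : R) : x != 0 ->
  fdet (fun a b : T => x * (a == b)%:R + y) = x ^+ #|T| * (1 + #|T|%:R * (y / x)).
Proof.
move=> x0; rewrite (eq_fdet (N := fun a b => x * ((a == b)%:R + 1 * (y / x)))).
  rewrite fdetZ fdet_1D; congr (_ * (_ + _)).
  by under eq_bigr do rewrite mulr1; rewrite sumr_const mulr_natl.
by move=> a b; rewrite mul1r mulrDr mulrCA divff ?mulr1.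
Qed.

End FunctionDeterminant.

(** * Spanning trees and parent functions *)

Section ParentFunctions.
Variables (V : finType) (G : sgraph V) (r : V).
Implicit Types f g : {ffun V -> V}.

Definition parent_edges f : {set {set V}} := [set [set v; f v] | v in [set~ r]].

Definition reaches f : bool := [forall v, fconnect f v r].

(** Prescribing the value at the root makes the parent function of a spanning tree unique. *)
Definition parent_fun f : bool :=
  [&& f r == r, [forall v, (v != r) ==> G v (f v)] & reaches f].

(** [findex f v r] counts the steps from [v] to [r] and serves as the depth of [v] in the tree. *)
Lemma parent_depth f v : reaches f -> v != r ->
  findex f v r = (findex f (f v) r).+1.
Proof. by move=> /forallP/(_ v) fv vr; rewrite fconnect_findex // eq_sym. Qed.

Lemma parent_fun_root f : parent_fun f -> f r = r.
Proof. by case/and3P => /eqP. Qed.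

Lemma parent_fun_adj f v : parent_fun f -> v != r -> G v (f v).
Proof. by case/and3P => _ /forallP/(_ v)/implyP. Qed.

Lemma parent_fun_reaches f : parent_fun f -> reaches f.
Proof. by case/and3P. Qed.

Lemma parent_edgesP f x y :
  reflect (x != r /\ y = f x \/ y != r /\ x = f y) ([set x; y] \in parent_edges f).
Proof.
apply: (iffP imsetP) => [[v] | [[xr ->] | [yr ->]]].
- rewrite !inE => vr E.
  have := set21 x y; have := set22 x y; rewrite E !inE.
  have := set21 v (f v); have := set22 v (f v); rewrite -E !inE.
  by move=> /orP[]/eqP E1 /orP[]/eqP E2 /orP[]/eqP E3 /orP[]/eqP E4;
    rewrite ?E4 ?E3; subst; auto; left; split=> //; congruence.
- by exists x; rewrite ?inE.
- by exists y; rewrite ?inE // setUC.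
Qed.

Lemma parent_edge_depth f x y : parent_fun f ->
  [set x; y] \in parent_edges f -> y = f x \/ (findex f x r < findex f y r)%N.
Proof.
move=> pf /parent_edgesP[[_ ->] | [yr ->]]; [by left | right].
by rewrite (parent_depth (parent_fun_reaches pf) yr).
Qed.

Lemma parent_connect f v : parent_fun f ->
  connect (edge_graph (parent_edges f)) v r.
Proof.
move=> pf; elim: {v}(findex f v r) {-2}v (erefl (findex f v r)) => [|k IH] v.
  by move/eqP; rewrite findex_eq0 => /eqP ->; apply: connect0.
have [-> | vr E] := eqVneq v r; first by rewrite findex0.
have {}E : findex f (f v) r = k.
  by move: E; rewrite (parent_depth (parent_fun_reaches pf) vr) => -[].
apply: connect_trans (IH _ E); apply: connect1.
rewrite /= /edge_rel; apply/andP; split.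
  apply/eqP => vE; have := parent_fun_adj pf vr.
  by rewrite -vE adj_irrefl.
by apply/parent_edgesP; left.
Qed.

Lemma edge_graph_sym (F : {set {set V}}) : connect_sym (edge_graph F).
Proof. by apply: sym_connect_sym; apply: adj_sym. Qed.

Lemma parent_edges_tree f : parent_fun f -> is_tree (edge_graph (parent_edges f)).
Proof.
move=> pf; apply/andP; split.
  apply/forallP => x; apply/forallP => y.
  apply: connect_trans (parent_connect x pf) _.
  by rewrite edge_graph_sym; apply: parent_connect.
apply/acyclicP => c c2 /andP[cyc uc].
have [x0 x0c] : exists x0, x0 \in c by case: c c2 {cyc uc} => // x0 c; exists x0; rewrite inE eqxx.
(* Both neighbours in the cycle of a vertex [v] of maximal depth are its parent. *)
case: (arg_maxnP (fun x => findex f x r) x0c) => v vc vmax.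
have [i s cE] := rot_to vc.
have cyc' : cycle (edge_graph (parent_edges f)) (v :: s) by rewrite -cE rot_cycle.
have uc' : uniq (v :: s) by rewrite -cE rot_uniq.
have s2 : (1 < size s)%N by rewrite -ltnS -[(size s).+1]/(size (v :: s)) -cE size_rot.
have mem x : x \in v :: s -> (findex f x r <= findex f v r)%N.
  by rewrite -cE mem_rot; apply: vmax.
case: s {cE} s2 cyc' uc' mem => // w s s1; case/lastP: s s1 => // s u _.
rewrite /= rcons_path last_rcons => /andP[/andP[_ vw] /andP[_ /andP[_ uv]]] /and3P[_ ws _] mem.
have {uv} : [set v; u] \in parent_edges f by rewrite setUC.
case/(parent_edge_depth pf) => [uE |]; last first.
  by rewrite ltnNge mem // !inE mem_rcons inE eqxx !orbT.
case/(parent_edge_depth pf): vw => [wE |]; last first.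
  by rewrite ltnNge mem // !inE eqxx orbT.
by move: ws; rewrite wE -uE mem_rcons inE eqxx.
Qed.

Lemma parent_edges_spanning f : parent_fun f ->
  parent_edges f \in spanning_trees G.
Proof.
move=> pf; rewrite inE parent_edges_tree // andbT.
apply/subsetP => e /imsetP[v]; rewrite !inE => vr ->.
by have := parent_fun_adj pf vr; rewrite -edgesE inE.
Qed.

(** By induction on the depth of [v] under [f]. The edge from [v] to [f v] also comes from [g], so
    either [g v = f v], or [g (f v) = v]. In the second case [f (f v) = v] by induction, and [v]
    would be two levels deeper than itself. *)
Lemma parent_edges_inj : {in parent_fun &, injective parent_edges}.
Proof.
move=> f g pf pg E; apply/ffunP => v.
elim: {v}(findex f v r) {-2}v (erefl (findex f v r)) => [|k IH] v.
  move/eqP; rewrite findex_eq0 => /eqP ->.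
  by rewrite (parent_fun_root pf) (parent_fun_root pg).
have [-> | vr] := eqVneq v r; first by rewrite findex0.
rewrite (parent_depth (parent_fun_reaches pf) vr) => -[/IH IHk].
have : [set v; f v] \in parent_edges g by rewrite -E; apply/parent_edgesP; left.
case/parent_edgesP => [[_ ->] // | [fvr vE]].
have := parent_depth (parent_fun_reaches pf) vr.
rewrite (parent_depth (parent_fun_reaches pf) fvr) IHk -vE => /eqP.
by rewrite -addn2 -{1}[findex f v r]addn0 eqn_add2l.
Qed.

(** The parent of a vertex is a neighbour in the tree that is closer to [r]; acyclicity leaves no
    room for edges of [F] other than the parent edges. *)
Lemma tree_parent_fun (F : {set {set V}}) : F \in spanning_trees G ->
  exists2 f : {ffun V -> V}, parent_fun f & parent_edges f = F.
Proof.
rewrite inE => /andP[FG /andP[conF /acyclicP acF]].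
set H := edge_graph F in conF acF.
(* Fixing the length makes this predicate boolean, so that [ex_minn] yields the distance to [r] in
   the tree. *)
pose walk v k := [exists p : k.-tuple V, path H v p && (last v p == r)].
have walkP v k : reflect (exists p : seq V, [/\ path H v p, last v p = r & size p = k]) (walk v k).
  apply: (iffP existsP) => [[p /andP[pp /eqP lp]] | [p [pp lp /eqP sp]]].
    by exists p; rewrite size_tuple.
  by exists (Tuple sp); rewrite /= pp lp eqxx.
have walk_ex v : exists k, walk v k.
  have /forallP/(_ v)/forallP/(_ r)/connectP[p pp lp] := conF.
  by exists (size p); apply/walkP; exists p.
pose dist v := ex_minn (walk_ex v).
have closer v : v != r -> exists w, H v w && (dist w < dist v)%N.
  move=> vr; rewrite {2}/dist; case: ex_minnP => k /walkP[[|w p] [/= pp lp sp]] _.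
    by move: vr; rewrite -lp eqxx.
  exists w; case/andP: pp => -> pp /=; rewrite -sp ltnS /dist.
  by case: ex_minnP => j _; apply; apply/walkP; exists p.
(* The default of [odflt] is never taken, because [closer] provides a neighbour. *)
pose f : {ffun V -> V} :=
  [ffun v => if v == r then r else odflt r [pick w | H v w && (dist w < dist v)%N]].
have fr : f r = r by rewrite ffunE eqxx.
have fP v : v != r -> H v (f v) && (dist (f v) < dist v)%N.
  move=> vr; rewrite ffunE (negPf vr); case: pickP => //= no.
  by have [w Hw] := closer v vr; have := no w; rewrite Hw.
have FE x y : H x y -> [set x; y] \in F by case/andP.
have pf : parent_fun f.
  apply/and3P; split; first by rewrite fr.
    apply/forallP => v; apply/implyP => /fP/andP[/FE/(subsetP FG)].
    by rewrite edgesE.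
  apply/forallP => v; elim: {v}(dist v).+1 {-2}v (ltnSn (dist v)) => // k IH v.
  rewrite ltnS => le; have [-> | vr] := eqVneq v r; first exact: connect0.
  have /andP[_ lt] := fP v vr.
  by apply: connect_trans (fconnect1 _ _) (IH _ (leq_trans lt le)).
exists f => //.
have sub : parent_edges f \subset F.
  by apply/subsetP => e /imsetP[v]; rewrite !inE => /fP/andP[/FE Fv _] ->.
apply/eqP; rewrite eqEsubset sub /=; apply/subsetP => e Fe.
have /subsetP/(_ e Fe) := FG; rewrite inE => /existsP[x /existsP[y /andP[Gxy /eqP eE]]].
subst e; apply/negPn/negP => nxy.
(* A further edge [xy] closes a cycle with the path from [x] to [y] through [r]. *)
have : connect (edge_graph (parent_edges f)) x y.
  apply: connect_trans (parent_connect x pf) _.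
  by rewrite edge_graph_sym; apply: parent_connect.
case/connectP => p0 p0p; case/shortenP: p0p => p pp up _ yE.
have xy : x != y by apply/eqP => E; move: Gxy; rewrite E adj_irrefl.
apply: (acF (x :: p)); last first.
  apply/andP; split; last exact: up.
  rewrite /= rcons_path -yE; apply/andP; split.
    by apply: sub_path pp => a b /andP[ab /(subsetP sub) Fab]; apply/andP.
  by rewrite /= /edge_rel eq_sym xy setUC.
(* Paths of length 0 and 1 are excluded by [xy] and [nxy], so the cycle has at least three
   vertices. *)
case: p yE pp {up} => [|w [|w' p]] //= yE; first by rewrite yE eqxx in xy.
by case/andP => /andP[_]; rewrite -yE (negPf nxy).
Qed.

Lemma nb_spanning_trees_parent : nb_spanning_trees G = #|parent_fun|.
Proof.
rewrite /nb_spanning_trees -(card_in_imset parent_edges_inj); congr #|pred_of_set _|.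
apply/setP => F; apply/idP/imsetP => [/tree_parent_fun[f pf <-] | [f pf ->]].
  by exists f.
exact: parent_edges_spanning.
Qed.

End ParentFunctions.

(** * Row expansions and special values of determinants *)

Section FunctionDeterminantExpansion.
Variables (R : fieldType) (T : finType).

(** Multilinearity in the rows: each product of the Leibniz formula is distributed over its sums. *)
Lemma fdet_sum_rows (U : finType) (F : T -> U -> T -> R) :
  fdet (fun x y => \sum_u F x u y) =
  \sum_(f : {ffun T -> U}) fdet (fun x y => F x (f x) y).
Proof.
rewrite /fdet /determinant exchange_big; apply: eq_bigr => s _ /=.
rewrite -mulr_sumr; congr (_ * _).
pose sg x := enum_val (s (enum_rank x)).
transitivity (\prod_x \sum_u F x u (sg x)).
  rewrite -(big_enum_val_all _ (fun x => \sum_u F x u (sg x))).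
  by apply: eq_bigr => i _; rewrite mxE /sg enum_valK.
rewrite bigA_distr_bigA /=; apply: eq_bigr => f _.
rewrite -(big_enum_val_all _ (fun x => F x (f x) (sg x))).
by apply: eq_bigr => i _; rewrite mxE /sg enum_valK.
Qed.

Lemma fdet_prod_rows (a : T -> R) (M : T -> T -> R) :
  fdet (fun x y => a x * M x y) = \prod_x a x * fdet M.
Proof.
rewrite /fdet /determinant mulr_sumr; apply: eq_bigr => s _.
rewrite mulrCA; congr (_ * _); rewrite -(big_enum_val_all _ a) -big_split /=.
by apply: eq_bigr => i _; rewrite !mxE.
Qed.

(* In the Leibniz formula, a permutation with a nonzero term moves a moved point of least
   height to a moved point of smaller height, so only the identity contributes. *)
Lemma fdet_height (h : T -> nat) (M : T -> T -> R) :
  (forall x y, x != y -> M x y != 0 -> (h y < h x)%N) -> fdet M = \prod_x M x x.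
Proof.
move=> Mh; rewrite /fdet /determinant (bigD1 (1%g : 'S_#|T|)) //= [X in _ + X]big1 => [|s s1].
  rewrite odd_perm1 mul1r addr0 -(big_enum_val_all _ (fun x => M x x)).
  by apply: eq_bigr => i _; rewrite mxE perm1.
apply/eqP; rewrite mulf_eq0 signr_eq0 /=; apply/negPn/negP => /prodf_neq0 nz.
have [i0 i0s] : exists i, s i != i.
  apply/existsP; apply: contraR s1 => /existsPn fx; apply/eqP/permP => i.
  by rewrite perm1; apply/eqP/negPn; apply: fx.
case: (@arg_minnP _ i0 (fun i => s i != i) (fun i => h (enum_val i)) i0s) => i si imin.
have := nz i isT; rewrite mxE => /Mh.
rewrite (inj_eq enum_val_inj) eq_sym => /(_ si).
by rewrite ltnNge imin // (inj_eq perm_inj).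
Qed.

Lemma fdet_ker (M : T -> T -> R) (u : T -> R) x0 :
  u x0 != 0 -> (forall x, \sum_y M x y * u y = 0) -> fdet M = 0.
Proof.
move=> u0 Mu; apply/eqP; rewrite /fdet -det_tr; apply/det0P.
exists (\row_i u (enum_val i)).
  by apply/eqP => /rowP/(_ (enum_rank x0)); rewrite !mxE enum_rankK; apply/eqP.
apply/rowP => i; rewrite !mxE -[RHS](Mu (enum_val i)).
rewrite -(big_enum_val_all _ (fun y => M (enum_val i) y * u y)).
by apply: eq_bigr => j _; rewrite !mxE mulrC.
Qed.

Lemma sum_delta (x : T) (F : T -> R) : \sum_y (x == y)%:R * F y = F x.
Proof.
rewrite (bigD1 x) //= eqxx mul1r big1 ?addr0 // => y; rewrite eq_sym => /negPf ->.
by rewrite mul0r.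
Qed.

Lemma sum_delta_const (x : T) : \sum_y (x == y)%:R = 1 :> R.
Proof. by rewrite -[RHS](sum_delta x (fun=> 1)); apply: eq_bigr => y _; rewrite mulr1. Qed.

End FunctionDeterminantExpansion.

(** * The matrix-tree theorem and the Laplacian spectrum *)

Section MatrixTree.
Variables (R : fieldType) (V : finType) (G : sgraph V).

Definition lap (x y : V) : R := (deg G x)%:R * (x == y)%:R - (G x y)%:R.

Lemma deg_sum x : (deg G x)%:R = \sum_y (G x y)%:R :> R.
Proof.
rewrite /deg -sum1_card natr_sum big_mkcond; apply: eq_bigr => y _.
by rewrite inE; case: (G x y).
Qed.

Lemma lap_sym x y : lap x y = lap y x.
Proof. by rewrite /lap adj_sym eq_sym; case: eqVneq => [-> //|_]; rewrite !mulr0. Qed.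

Lemma lap_row_sum x : \sum_y lap x y = 0.
Proof. by rewrite sumrB -mulr_sumr sum_delta_const mulr1 deg_sum subrr. Qed.

Lemma lap_col_sum y : \sum_x lap x y = 0.
Proof. by under eq_bigr do rewrite lap_sym; apply: lap_row_sum. Qed.

Variable r : V.

(** Expanding along the row of [r] shows that its determinant is the principal cofactor of the
    Laplacian at [r]. *)
Definition grounded_lap (x y : V) : R := if x == r then (x == y)%:R else lap x y.

(** If all vertices lead to [r], the matrix is unitriangular with respect to depth. Otherwise the
    indicator of the vertices that do not lead to [r] lies in its kernel. *)
Lemma fdet_parent (f : {ffun V -> V}) : f r = r ->
  fdet (fun x y => (x == y)%:R - (x != r)%:R * (f x == y)%:R) = (reaches r f)%:R :> R.
Proof.
move=> fr; have [rf | /forallPn[x0 x0r]] := boolP (reaches r f).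
  rewrite (fdet_height (h := fun x => findex f x r)) => [|x y xy].
    apply: big1 => x _; rewrite eqxx; have [-> | xr] := eqVneq x r.
      by rewrite mul0r subr0.
    rewrite mul1r; case: eqVneq => [fx|]; last by rewrite subr0.
    by have := parent_depth rf xr; rewrite fx => /eqP; rewrite -addn1 -{1}[findex f x r]addn0 eqn_add2l.
  rewrite (negPf xy) sub0r oppr_eq0.
  have [-> | xr] := eqVneq x r; first by rewrite mul0r eqxx.
  by case: (eqVneq (f x) y) => [<- | _]; rewrite ?(parent_depth rf xr) // mulr0 eqxx.
apply: (fdet_ker (u := fun x => (~~ fconnect f x r)%:R) (x0 := x0)).
  by rewrite x0r oner_neq0.
move=> x; under eq_bigr do rewrite mulrBl -mulrA.
rewrite sumrB sum_delta -mulr_sumr sum_delta.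
have [-> | xr] := eqVneq x r; first by rewrite connect0 /= mul0r subr0.
suff -> : fconnect f x r = fconnect f (f x) r by rewrite mul1r subrr.
apply/idP/idP => [xcr | ]; last exact: connect_trans (fconnect1 f x).
have := iter_findex xcr; rewrite fconnect_findex // 1?eq_sym // iterSr => <-.
exact: fconnect_iter.
Qed.

Lemma fdet_grounded_lap : fdet grounded_lap = (nb_spanning_trees G)%:R :> R.
Proof.
(* Row [x] is the sum over [u] of the rows [d x u] with coefficients [c x u]; for [x = r] only
   [u = r] contributes. *)
pose c x u : R := if x == r then (u == r)%:R else (G x u)%:R.
pose d x u y : R := (x == y)%:R - (x != r)%:R * (u == y)%:R.
rewrite (eq_fdet (N := fun x y => \sum_u c x u * d x u y)) => [|x y].
  rewrite fdet_sum_rows (nb_spanning_trees_parent G r) -sum1_card natr_sum [RHS]big_mkcond.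
  apply: eq_bigr => f _; rewrite fdet_prod_rows unfold_in /parent_fun.
  (* The coefficients test the first two conditions of [parent_fun], and the determinant in
     [fdet_parent] tests the third. *)
  have -> : \prod_x c x (f x) = ((f r == r) && [forall v, (v != r) ==> G v (f v)])%:R.
    rewrite (bigD1 r) //= {1}/c eqxx; case: eqP => _; last by rewrite mul0r.
    rewrite mul1r; case: forallP => [Gf | /forallP/forallPn[v]].
      apply: big1 => v vr; rewrite /c (negPf vr).
      by have := implyP (Gf v) vr => ->.
    rewrite negb_imply => /andP[vr nG].
    by rewrite (bigD1 v) //= /c (negPf vr) (negPf nG) mul0r.
  rewrite andbA; case: andP => [[/eqP fr _] | _]; last by rewrite mul0r.
  by rewrite mul1r fdet_parent //; case: (reaches r f).
rewrite /grounded_lap /c /d; have [-> | xr] := eqVneq x r.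
  under eq_bigr do rewrite mul0r subr0.
  by rewrite -mulr_suml; under eq_bigr do rewrite eq_sym; rewrite sum_delta_const mul1r.
under eq_bigr do rewrite mul1r mulrBr.
rewrite sumrB -mulr_suml -deg_sum; congr (_ - _).
by under eq_bigr do rewrite mulrC eq_sym; rewrite sum_delta.
Qed.

(* With [a] the indicator of [r] and [w = 1 - a], one has
   L + J = (1 + w a^T) (1 + (w - a) w^T) L_r (1 + 1 w^T), where [L_r] is the grounded Laplacian
   and the other factors have determinants 1, n and n. *)
Lemma fdet_lap1_root :
  fdet (fun x y => lap x y + 1) = #|V|%:R ^+ 2 * (nb_spanning_trees G)%:R :> R.
Proof.
pose a x : R := (r == x)%:R; pose w x : R := 1 - a x.
have sa : \sum_x a x = 1 by apply: sum_delta_const.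
have sw : \sum_x w x = #|V|%:R - 1 by rewrite sumrB sa sumr_const.
have aa x : a x * a x = a x by rewrite /a -natrM mulnb andbb.
have aw x : a x * w x = 0 by rewrite /w mulrBr mulr1 aa subrr.
have ww x : w x * w x = w x by rewrite {1}/w mulrBl mul1r aw subr0.
pose M1 x z : R := if x == r then 1 else lap x z.
have E1 : fdet M1 = #|V|%:R * (nb_spanning_trees G)%:R.
  rewrite (eq_fdet (N := fun x z => \sum_y grounded_lap x y * ((y == z)%:R + 1 * w z))).
    rewrite fdetM fdet_grounded_lap fdet_1D mulrC; congr (_ * _).
    by under eq_bigr do rewrite mulr1; rewrite sw addrC subrK.
  move=> x z; under eq_bigr do rewrite mulrDr mul1r.
  rewrite big_split -mulr_suml /=.
  under eq_bigr do rewrite mulrC eq_sym.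
  rewrite sum_delta /M1 /grounded_lap; case: eqVneq => [-> | _].
    by rewrite sum_delta_const mul1r addrC subrK.
  by rewrite lap_row_sum mul0r addr0.
pose M2 x z : R := if x == r then 1 + lap r z else lap x z - lap r z.
have E2 : fdet M2 = #|V|%:R * fdet M1.
  rewrite (eq_fdet (N := fun x z => \sum_y ((x == y)%:R + (w x - a x) * w y) * M1 y z)).
    rewrite fdetM fdet_1D; congr (_ * _).
    under eq_bigr do rewrite mulrBr ww mulrC aw subr0.
    by rewrite sw addrC subrK.
  move=> x z; under eq_bigr do rewrite mulrDl -mulrA.
  rewrite big_split sum_delta -mulr_sumr /=.
  (* The columns of the Laplacian sum to 0, so the rows other than that of [r] add up to minus the
     row of [r]. *)
  have -> : \sum_y w y * M1 y z = - lap r z.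
    transitivity (\sum_y (lap y z - (r == y)%:R * lap y z)).
      apply: eq_bigr => y _; rewrite /M1 /w /a eq_sym.
      by case: eqVneq => [-> | _]; rewrite ?subrr ?subr0 ?mul1r ?mul0r ?subrr ?subr0.
    by rewrite sumrB lap_col_sum sum_delta sub0r.
  rewrite /M2 /M1 /w /a [r == x]eq_sym; case: eqVneq => _ /=; ring.
rewrite (eq_fdet (N := fun x z => \sum_y ((x == y)%:R + w x * a y) * M2 y z)).
  rewrite fdetM E2 E1 fdet_1D big1 => [|x _]; last exact: aw.
  by rewrite addr0 mul1r mulrA -expr2.
move=> x z; under eq_bigr do rewrite mulrDl -mulrA.
rewrite big_split sum_delta -mulr_sumr sum_delta /= /M2 /w /a eqxx [r == x]eq_sym.
case: eqVneq => [-> | _] /=; ring.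
Qed.

End MatrixTree.

Theorem matrix_tree (R : fieldType) (V : finType) (G : sgraph V) : (0 < #|V|)%N ->
  fdet (fun x y => lap R G x y + 1) = #|V|%:R ^+ 2 * (nb_spanning_trees G)%:R.
Proof. by case/card_gt0P => r _; apply: fdet_lap1_root. Qed.

Section Spectrum.
Variables (R : rcfType) (V : finType) (G : sgraph V).

Lemma laplacianE : laplacian R G = fun_mx (lap R G).
Proof.
apply/matrixP => i j; rewrite !mxE /lap (inj_eq enum_val_inj).
by rewrite mulr_natr.
Qed.

Lemma horner_char_poly (F : fieldType) n (A : 'M[F]_n) a :
  (char_poly A).[a] = \det (a%:M - A).
Proof.
rewrite /char_poly -horner_evalE -det_map_mx; congr (\det _).
apply/matrixP => i j; rewrite !mxE /= horner_evalE !hornerE.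
by case: (i == j); rewrite ?hornerE.
Qed.

(** At a vertex [x] where the square of the eigenvector [u] is maximal, [a * u x ^+ 2] is the sum of
    [(u x - u y) * u x] over the neighbours [y], and every term is nonnegative. *)
Lemma laplacian_spectrum_ge0 a : a \in laplacian_spectrum R G -> 0 <= a.
Proof.
rewrite -root_prod_XsubC -char_poly_laplacian -eigenvalue_root_char.
case/eigenvalueP => v vL v0.
have [i0 vi0] : exists i, v 0 i != 0.
  apply/existsP; apply: contraR v0 => /existsPn z; apply/eqP/rowP => i.
  by rewrite mxE; apply/eqP/negPn; apply: z.
pose u x := v 0 (enum_rank x).
have Lu x : \sum_y (G x y)%:R * (u x - u y) = a * u x.
  have /rowP/(_ (enum_rank x)) := vL; rewrite !mxE => <-.
  rewrite laplacianE; transitivity (\sum_y u y * lap R G y x).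
    transitivity (\sum_y ((x == y)%:R * ((deg G y)%:R * u y) - (G x y)%:R * u y)).
      rewrite sumrB sum_delta deg_sum mulr_suml -sumrB.
      by apply: eq_bigr => y _; rewrite mulrBr.
    by apply: eq_bigr => y _; rewrite /lap eq_sym adj_sym; ring.
  rewrite -(big_enum_val_all _ (fun y => u y * _)).
  by apply: eq_bigr => j _; rewrite !mxE /u enum_valK enum_rankK.
have [x _ xmax] := arg_maxP (fun x => u x ^+ 2) (erefl : xpredT (enum_val i0)).
have ux : 0 < u x ^+ 2.
  apply: lt_le_trans (xmax (enum_val i0) isT).
  by rewrite /u enum_valK exprn_even_gt0.
rewrite -(pmulr_lge0 _ ux) expr2 mulrA -Lu mulr_suml sumr_ge0 // => y _.
rewrite -mulrA mulr_ge0 ?ler0n //.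
have : u y ^+ 2 <= u x ^+ 2 := xmax y isT.
have : 0 <= (u x - u y) ^+ 2 by apply: sqr_ge0.
by rewrite !expr2; nra.
Qed.

(** The constant vector gives the eigenvalue 0, and no eigenvalue is negative, so 0 comes first in
    the sorted spectrum. *)
Lemma mu1 : (0 < #|V|)%N -> mu R G 1 = 0.
Proof.
move=> V0; have sz := size_laplacian_spectrum R G.
have z : 0 \in laplacian_spectrum R G.
  rewrite -root_prod_XsubC -char_poly_laplacian /root horner_char_poly.
  rewrite [0%:M](_ : _ = 0) ?sub0r; last by apply/matrixP => i j; rewrite !mxE mul0rn.
  rewrite laplacianE -scaleN1r detZ mulf_eq0; apply/orP; right; apply/eqP.
  have [x0 _] := card_gt0P V0.
  apply: (fdet_ker (u := fun=> 1) (x0 := x0)); first exact: oner_neq0.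
  by move=> x; under eq_bigr do rewrite mulr1; apply: lap_row_sum.
apply/eqP; rewrite eq_le /mu /=; apply/andP; split; last first.
  by apply: laplacian_spectrum_ge0; rewrite mem_nth // sz.
rewrite -{2}[0](nth_index 0 z); apply: le_sorted_leq_nth => //.
- exact: laplacian_spectrum_sorted.
- by rewrite inE sz.
- by rewrite inE index_mem.
Qed.

(** Up to the sign [(-1) ^+ #|V|], this is the characteristic polynomial at [- x]. *)
Lemma fdet_lap_scalarD x :
  fdet (fun a b => x * (a == b)%:R + lap R G a b) = \prod_(1 <= i < #|V|.+1) (x + mu R G i).
Proof.
rewrite big_add1 /= /mu /= -(size_laplacian_spectrum R G).
rewrite -(big_nth 0 xpredT (fun m => x + m)).
apply: (mulfI (x := (-1) ^+ #|V|)); first by rewrite signr_eq0.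
rewrite -fdetZ -(size_laplacian_spectrum R G).
transitivity (char_poly (laplacian R G)).[- x].
  rewrite horner_char_poly laplacianE; congr (\det _); apply/matrixP => i j.
  rewrite !mxE (inj_eq enum_val_inj) mulN1r opprD; congr (_ - _).
  by rewrite mulr_natr mulNrn.
rewrite char_poly_laplacian horner_prod.
elim: (laplacian_spectrum R G) => [|m s IH]; first by rewrite !big_nil mulr1.
rewrite !big_cons IH /= exprS !hornerE /=; ring.
Qed.

(** Since L J = 0, the matrix factors as (x + L)(1 + (y/x) J), and the second factor is a rank-one
    perturbation of the identity. *)
Lemma fdet_lap_scalarD_const x y : x != 0 -> (0 < #|V|)%N ->
  fdet (fun a b => x * (a == b)%:R + lap R G a b + y)
  = (x + #|V|%:R * y) * \prod_(2 <= i < #|V|.+1) (x + mu R G i).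
Proof.
move=> x0 V0.
rewrite (eq_fdet (N := fun a c => \sum_b (x * (a == b)%:R + lap R G a b) *
                                         ((b == c)%:R + 1 * (y / x)))).
  rewrite fdetM fdet_lap_scalarD fdet_1D big_ltn // mu1 // addr0.
  by rewrite mulr1 sumr_const -mulr_natl; field.
move=> a c; under eq_bigr do rewrite mulrDr.
rewrite big_split -mulr_suml big_split lap_row_sum -mulr_sumr sum_delta_const /=.
under eq_bigr do rewrite mulrC eq_sym.
by rewrite sum_delta; field.
Qed.

End Spectrum.

(** * The subdivision-edge join *)

Section Incidence.
Variables (R : fieldType) (V : finType) (G : sgraph V).
Implicit Types (x y : V) (e : edge_type G).

Definition inc x e : R := (x \in val e)%:R.

Lemma card_edge e : #|val e| = 2%N.
Proof.
have := valP e; rewrite inE => /existsP[a /existsP[b /andP[Gab /eqP ->]]].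
by rewrite cards2; case: eqVneq Gab => // ->; rewrite adj_irrefl.
Qed.

Lemma inc_vertices e : \sum_x inc x e = 2.
Proof.
rewrite -(card_edge e) -sum1_card natr_sum [RHS]big_mkcond.
by apply: eq_bigr => x _; rewrite /inc; case: (x \in _).
Qed.

(** An edge has exactly two vertices, so only the edge joining [x] and [y] contains both. *)
Lemma inc_pair x y : x != y -> \sum_e inc x e * inc y e = (G x y)%:R.
Proof.
move=> xy; have incE e : inc x e * inc y e = (val e == [set x; y])%:R.
  rewrite -natrM mulnb; congr ((nat_of_bool _)%:R).
  apply/andP/eqP => [[xe ye] | ->]; last by rewrite set21 set22.
  apply/esym/eqP; rewrite eqEcard card_edge cards2 xy andbT.
  by apply/subsetP => z; rewrite !inE => /orP[] /eqP ->.
under eq_bigr do rewrite incE.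
rewrite -edgesE; case: (boolP ([set x; y] \in edges G)) => [Exy | nE].
  rewrite (bigD1 (exist _ [set x; y] Exy : edge_type G)) //= eqxx big1 ?addr0 // => e.
  by rewrite -val_eqE /= => /negPf ->.
apply: big1 => e _; case: eqP => // eE; have := valP e.
by rewrite eE (negPf nE).
Qed.

(* Counting the pairs [(y, e)] with [x, y \in e] in two ways. *)
Lemma inc_edges x : \sum_e inc x e = (deg G x)%:R.
Proof.
have ii y e : inc y e * inc y e = inc y e by rewrite /inc -natrM mulnb andbb.
have : \sum_e \sum_y inc x e * inc y e = 2 * \sum_e inc x e.
  by rewrite mulr_sumr; apply: eq_bigr => e _; rewrite -mulr_sumr inc_vertices mulrC.
rewrite exchange_big (bigD1 x) //=; under eq_bigr do rewrite ii.
rewrite mulr_natl mulr2n => /addrI <-.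
rewrite deg_sum [RHS](bigD1 x) //= adj_irrefl add0r.
by apply: eq_bigr => y yx; rewrite inc_pair // eq_sym.
Qed.

(** This is the signless Laplacian D + A; for a regular graph of degree r it equals 2r - L, which is
    how L(G1) enters the Schur complement. *)
Lemma inc_gram x y :
  \sum_e inc x e * inc y e = (deg G x)%:R * (x == y)%:R + (G x y)%:R.
Proof.
have [<- | xy] := eqVneq x y; last by rewrite inc_pair // mulr0 add0r.
rewrite adj_irrefl addr0 mulr1 -inc_edges; apply: eq_bigr => e _.
by rewrite /inc -natrM mulnb andbb.
Qed.

Lemma handshake : \sum_x (deg G x)%:R = 2 * #|edges G|%:R :> R.
Proof.
under eq_bigr do rewrite -inc_edges.
rewrite exchange_big /=; under eq_bigr do rewrite inc_vertices.
by rewrite sumr_const card_sig mulr_natr; congr (_ *+ _); apply: eq_card => e; rewrite inE.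
Qed.

End Incidence.

Section JoinLaplacian.
Variables (R : fieldType) (V1 V2 : finType) (G1 : sgraph V1) (G2 : sgraph V2).
Local Notation H := (subdivision_edge_join G1 G2).
Local Notation L := (lap R H).

Lemma inserted_inl x : (inl x \in inserted G1) = false.
Proof. by apply/negP => /imsetP[]. Qed.

Lemma inserted_inr e : inr e \in inserted G1.
Proof. by apply: imset_f. Qed.

Lemma deg_join_vertex x : (deg H (inl (inl x)))%:R = (deg G1 x)%:R :> R.
Proof.
rewrite deg_sum !big_sumType /= inserted_inl -inc_edges.
by rewrite [X in X + _ + _]big1 // [X in _ + X]big1 // add0r addr0.
Qed.

Lemma deg_join_edge e : (deg H (inl (inr e)))%:R = 2 + #|V2|%:R :> R.
Proof.
rewrite deg_sum !big_sumType /= inserted_inr [X in _ + X + _]big1 // addr0 sumr_const.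
by rewrite -(inc_vertices R e).
Qed.

Lemma deg_join_right u : (deg H (inr u))%:R = #|edges G1|%:R + (deg G2 u)%:R :> R.
Proof.
rewrite [LHS]deg_sum !big_sumType /=.
under eq_bigr do rewrite inserted_inl.
rewrite [X in X + _ + _]big1 // add0r; under eq_bigr do rewrite inserted_inr.
rewrite sumr_const card_sig -deg_sum; congr (_ *+ _ + _).
Qed.

Lemma lap_join_VV x y : L (inl (inl x)) (inl (inl y)) = (deg G1 x)%:R * (x == y)%:R.
Proof. by rewrite /lap deg_join_vertex subr0. Qed.

Lemma lap_join_VE x e : L (inl (inl x)) (inl (inr e)) = - inc R x e.
Proof. by rewrite /lap mulr0 sub0r. Qed.

Lemma lap_join_VR x u : L (inl (inl x)) (inr u) = 0.
Proof. by rewrite /lap /= inserted_inl mulr0 subr0. Qed.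

Lemma lap_join_EE e f :
  L (inl (inr e)) (inl (inr f)) = (2 + #|V2|%:R) * (e == f)%:R.
Proof. by rewrite /lap deg_join_edge subr0. Qed.

Lemma lap_join_ER e u : L (inl (inr e)) (inr u) = -1.
Proof. by rewrite /lap /= inserted_inr mulr0 sub0r. Qed.

Lemma lap_join_RR u v :
  L (inr u) (inr v) = #|edges G1|%:R * (u == v)%:R + lap R G2 u v.
Proof. by rewrite /lap deg_join_right mulrDl addrA. Qed.

End JoinLaplacian.

Lemma nb_spanning_trees_isolated (V : finType) (G : sgraph V) (x y : V) :
  x != y -> deg G x = 0%N -> nb_spanning_trees G = 0%N.
Proof.
move=> xy dx; apply/eqP; rewrite cards_eq0; apply/eqP/setP => F; rewrite !inE.
apply/negP => /and3P[FG /forallP/(_ x)/forallP/(_ y)/connectP[p pp yE] _].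
case: p pp yE => [_ /esym/eqP | z p /=]; first by rewrite (negPf xy).
case/andP => /andP[_ /(subsetP FG)]; rewrite edgesE => Gxz _ _.
by have /eqP := dx; rewrite cards_eq0 => /eqP/setP/(_ z); rewrite !inE Gxz.
Qed.

(** * The determinant of L + J for the join *)

Section JoinDeterminant.
Variables (R : rcfType) (V1 V2 : finType) (G1 : sgraph V1) (G2 : sgraph V2).
Variable d : nat.
Hypotheses (V1_gt0 : (0 < #|V1|)%N) (V2_gt0 : (0 < #|V2|)%N).
Hypotheses (G1_regular : regular G1 d) (d_gt0 : (0 < d)%N).
Local Notation H := (subdivision_edge_join G1 G2).
Local Notation L := (lap R H).
Local Notation n := (#|V1|%:R : R).
Local Notation m := (#|edges G1|%:R : R).
Local Notation k := (#|V2|%:R : R).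
Local Notation r := (d%:R : R).

Lemma regular_handshake : n * r = 2 * m.
Proof.
rewrite -handshake; under eq_bigr do rewrite G1_regular.
by rewrite sumr_const mulr_natl.
Qed.

Let k_gt0 : 0 < k. Proof. by rewrite ltr0n. Qed.
Let r_gt0 : 0 < r. Proof. by rewrite ltr0n. Qed.
Let n_gt0 : 0 < n. Proof. by rewrite ltr0n. Qed.
Let m_ge0 : 0 <= m. Proof. exact: ler0n. Qed.
Let mk_neq0 : m + k != 0. Proof. by apply: lt0r_neq0; move: k_gt0 m_ge0 n_gt0; lra. Qed.
Let k2_neq0 : 2 + k != 0. Proof. by apply: lt0r_neq0; move: k_gt0 m_ge0 n_gt0; lra. Qed.
Let k2m_neq0 : 2 + k + m != 0. Proof. by apply: lt0r_neq0; move: k_gt0 m_ge0 n_gt0; lra. Qed.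

Lemma card_edge_type : #|edge_type G1| = #|edges G1|.
Proof. by rewrite card_sig; apply: eq_card => e; rewrite inE. Qed.

Lemma sum_co_inc x : \sum_(e : edge_type G1) (1 - inc R x e) = m - r.
Proof. by rewrite sumrB inc_edges G1_regular sumr_const card_edge_type. Qed.

Lemma co_inc_gram x y :
  \sum_(e : edge_type G1) (1 - inc R x e) * (1 - inc R y e)
  = m - 2 * r + r * (x == y)%:R + (G1 x y)%:R.
Proof.
under eq_bigr do rewrite mulrBr mulr1 mulrBl mul1r opprB addrC.
rewrite big_split sumrB /= inc_gram sum_co_inc inc_edges !G1_regular; ring.
Qed.

(** The Schur complement of V(G2) in L + J. Only the block on V(G1) is corrected, since the block
    between I(G1) and V(G2) is 0. *)
Definition join_VE (a b : V1 + edge_type G1) : R :=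
  match a, b with
  | inl x, inl y => r * (x == y)%:R + 1 - k / (m + k)
  | inl x, inr e | inr e, inl x => 1 - inc R x e
  | inr e, inr f => (2 + k) * (e == f)%:R + 1
  end.

Lemma fdet_join_right :
  fdet (fun a b => L a b + 1) =
  fdet join_VE * ((m + k) * \prod_(2 <= i < #|V2|.+1) (m + mu R G2 i)).
Proof.
(* The rows of the block on V(G2) all sum to [m + k], so a constant vector solves the system with
   the all-ones right-hand side. *)
rewrite (fdet_schur (X := fun u a => if a is inl _ then (m + k)^-1 else 0)); last first.
  move=> u [x | e]; last first.
    by rewrite lap_sym lap_join_ER addNr big1 // => v _; rewrite mulr0.
  rewrite -mulr_suml lap_sym lap_join_VR add0r.
  under eq_bigr do rewrite lap_join_RR.
  rewrite 2!big_split /= -mulr_sumr sum_delta_const lap_row_sum sumr_const.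
  by rewrite mulr1 addr0 divff.
congr (_ * _).
  apply: eq_fdet => -[x | e] [y | f] /=.
  - under eq_bigr do rewrite lap_join_VR add0r mul1r.
    by rewrite sumr_const lap_join_VV G1_regular -[_^-1 *+ _]mulr_natl.
  - rewrite big1 => [|u _]; last by rewrite mulr0.
    by rewrite lap_join_VE subr0 addrC.
  - under eq_bigr do rewrite lap_join_ER addNr mul0r.
    by rewrite big1_eq subr0 lap_sym lap_join_VE addrC.
  - under eq_bigr do rewrite lap_join_ER addNr mul0r.
    by rewrite big1_eq subr0 lap_join_EE.
(* The spectral formula requires [m != 0], which follows from [n * r = 2 * m] with [n] and [r]
   positive. *)
have [m0 | m0] := eqVneq m 0; last first.
  rewrite -[X in (_ + X) * _]mulr1 -fdet_lap_scalarD_const //.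
  by apply: eq_fdet => u v; rewrite lap_join_RR.
by have := regular_handshake; rewrite m0 mulr0 => /eqP; rewrite mulf_eq0 !gt_eqF.
Qed.

(** The coefficient of J in the second Schur complement after multiplication by [2 + k]. *)
Let c : R := (2 + k) * m / (m + k) - (m - 2 * r) + (m - r) ^+ 2 / (2 + k + m).

Lemma fdet_join_VE :
  fdet join_VE =
  (2 + k) ^+ #|edges G1| * ((2 + k + m) / (2 + k)) * (2 + k)^-1 ^+ #|V1|
  * ((r * k + n * c) * \prod_(2 <= i < #|V1|.+1) (r * k + mu R G1 i)).
Proof.
(* The inverse of (2 + k) + J sends a vector with entry sum s to the vector minus s / (2 + k + m),
   all divided by 2 + k; here s is [m - r] by [sum_co_inc]. *)
pose q := (m - r) / (2 + k + m).
rewrite (fdet_schur (X := fun e x => (1 - inc R x e - q) / (2 + k))); last first.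
  move=> e x /=; under eq_bigr do rewrite mulrDl mul1r -mulrA.
  rewrite big_split -mulr_sumr sum_delta -mulr_suml sumrB sum_co_inc sumr_const /=.
  rewrite -mulr_natl card_edge_type /q; field.
  by rewrite k2_neq0 k2m_neq0.
rewrite mulrC -[RHS]mulrA; congr (_ * _).
  rewrite /= fdet_scalarD // card_edge_type; congr (_ * _); field.
  exact: k2_neq0.
(* The Schur complement on V(G1), multiplied by [2 + k], is r k + L(G1) + c J. *)
rewrite -fdet_lap_scalarD_const ?mulf_neq0 ?gt_eqF // -fdetZ.
apply: eq_fdet => x y /=.
under eq_bigr do rewrite mulrA mulrBr.
rewrite -mulr_suml sumrB co_inc_gram -mulr_suml sum_co_inc /lap G1_regular /c /q; field.
by rewrite k2_neq0 k2m_neq0 mk_neq0.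
Qed.

Lemma nb_spanning_trees_join :
  (nb_spanning_trees H)%:R =
  (2 + k) ^+ #|edges G1| / (2 + k) ^+ #|V1| * (r * k + r * m + 2 * m)
  * \prod_(2 <= i < #|V2|.+1) (m + mu R G2 i)
  * \prod_(2 <= i < #|V1|.+1) (r * k + mu R G1 i) / (m + n + k).
Proof.
have N0 : m + n + k != 0 by apply: lt0r_neq0; move: k_gt0 m_ge0 n_gt0; lra.
have card0 : (0 < #|{: (V1 + edge_type G1) + V2}|)%N.
  by rewrite !card_sum addn_gt0 V2_gt0 orbT.
have := matrix_tree R H card0.
rewrite fdet_join_right fdet_join_VE !card_sum card_edge_type !natrD.
set P1 := \prod_(_ <= i < _) _; set P2 := \prod_(_ <= i < _) _.
rewrite exprVn; set A := _ ^+ #|edges G1|; set B := _ ^+ #|V1|.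
have B0 : B != 0 by rewrite expf_neq0.
have key : (2 + k + m) / (2 + k) * (r * k + n * c) * (m + k)
    = (m + n + k) * (r * k + r * m + 2 * m).
  (* The identity depends on the handshake relation, so [r] is eliminated before [field]. *)
  have rE : r = 2 * m / n by rewrite -regular_handshake mulrAC divff ?gt_eqF // mul1r.
  rewrite /c rE; field.
  by rewrite k2_neq0 k2m_neq0 mk_neq0 gt_eqF.
move=> E; apply: (mulfI (x := (n + m + k) ^+ 2)).
  by rewrite expf_neq0 // [n + m]addrC.
rewrite -E; transitivity (A / B * ((2 + k + m) / (2 + k) * (r * k + n * c) * (m + k)) * P1 * P2).
  by field; rewrite B0 k2_neq0.
by rewrite key; field; rewrite B0 N0.
Qed.

End JoinDeterminant.

Theorem corollary3p6 (R : rcfType) (V1 V2 : finType)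
    (G1 : sgraph V1) (G2 : sgraph V2) (r1 n1 m1 n2 : nat)
    (n1_gt0 : (0 < n1)%N) (n2_gt0 : (0 < n2)%N)
    (card_V1 : #|V1| = n1) (card_E1 : #|edges G1| = m1)
    (card_V2 : #|V2| = n2) (G1_regular : regular G1 r1) :
  (nb_spanning_trees (subdivision_edge_join G1 G2))%:R =
    ((2 + n2)%:R ^ (m1%:Z - n1%:Z)
       * (r1 * n2 + r1 * m1 + 2 * m1)%:R
       * (\prod_(2 <= i < n2.+1) (m1%:R + mu R G2 i))
       * (\prod_(2 <= i < n1.+1) ((r1 * n2)%:R + mu R G1 i)))
    / (m1 + n1 + n2)%:R :> R.
Proof.
subst n1 m1 n2; case: (posnP r1) => [r0 | r1_gt0].
  have m0 : #|edges G1| = 0%N.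
    have := regular_handshake R G1_regular; rewrite r0 mulr0 => /esym/eqP.
    by rewrite mulf_eq0 !pnatr_eq0 => /eqP.
  rewrite m0 r0 !mul0n muln0 !mulr0 !mul0r.
  have [[x _] [u _]] := (card_gt0P n1_gt0, card_gt0P n2_gt0).
  rewrite (nb_spanning_trees_isolated (x := inl (inl x)) (y := inr u)) //.
  by apply/eqP; rewrite -(pnatr_eq0 R) deg_join_vertex G1_regular r0.
rewrite (nb_spanning_trees_join R G2 n1_gt0 n2_gt0 G1_regular r1_gt0).
(* The exponent may be negative; the power splits because its base is nonzero. *)
rewrite -!natrM -!natrD expfzDr ?pnatr_eq0 //.
by rewrite -exprnP -exprnN.
Qed.
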